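(* Let $A$ be adequate, $N\in A$, and suppose that $A$ is $N$-closed, i.e. for all $M\in A$, if $M\cap\beta_{M,N}\in Sk(N)$ then $M\cap\beta_{M,N}\in A$. Let $B$ be adequate such that $A\cap Sk(N)\subseteq B\subseteq Sk(N)$. Then $A\cup B$ is adequate.
   Context: Standing assumptions and notation. Assume $2^{\omega_1}=\omega_2$ and fix a bijection $\pi:\omega_2\to H(\omega_2)$. $P_{\omega_1}(\omega_2)$ is the set of countable subsets of $\omega_2$. Assume there is a stationary set $\mathcal{Y}\subseteq P_{\omega_1}(\omega_2)$ which is thin, i.e. for all $\beta<\omega_2$ the set $\{a\cap\beta: a\in\mathcal{Y}\}$ has size at most $\omega_1$; fix such a $\mathcal{Y}$ which is moreover closed under initial segments ($a\in\mathcal{Y}$, $\beta<\omega_2$ imply $a\cap\beta\in\mathcal{Y}$). Let $\mathcal{A}$ be the structure $(H(\omega_2),\in,\pi,\mathcal{Y})$, which has definable Skolem functions (via the well-ordering induced by $\pi$). For $a\subseteq H(\omega_2)$, $Sk(a)$ is the closure of $a$ under a fixed set of definable Skolem functions for $\mathcal{A}$. Let $C$ be the (club) set of $\beta<\omega_2$ with $Sk(\beta)\cap\omega_2=\beta$, and let $\Lambda$ be the set of $\beta<\omega_2$ of cofinality $\omega_1$ which are limit points of $C$. Let $\mathcal{X}$ be the set of $M\in\mathcal{Y}$ such that $Sk(M)\cap\omega_2=M$ and for all $\gamma\in M$, $\sup(C\cap\gamma)\in M$. Comparison points and adequacy. Fix a set $\Gamma\subseteq\Lambda$ which is stationary in $\omega_2$.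 For $M\in\mathcal{X}$, $\Gamma_M$ is the set of $\beta\in\Gamma$ such that $\beta=\min(\Gamma\setminus\sup(M\cap\beta))$, i.e. $\Gamma\cap[\sup(M\cap\beta),\beta)=\emptyset$. For $M,N\in\mathcal{X}$, $\Gamma_M\cap\Gamma_N$ has a largest element, denoted $\beta_{M,N}$. A set $A\subseteq\mathcal{X}$ is adequate if for all $M,N\in A$, either $M\cap\beta_{M,N}=N\cap\beta_{M,N}$, or $M\cap\beta_{M,N}\in Sk(N)$, or $N\cap\beta_{M,N}\in Sk(M)$. *)

(* Defs.v *)
From HB Require Import structures.
From mathcomp Require Import all_boot.
From mathcomp Require Import all_classical.
Set Implicit Arguments.
Unset Strict Implicit.
Unset Printing Implicit Defensive.
Local Open Scope quotient_scope.
Local Open Scope classical_set_scope.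
Local Open Scope card_scope.

(** [V] is Aczel's type of well-founded trees modulo bisimilarity, so that
    equality of sets is Leibniz equality.  Subclasses of [V] are terms of type
    [set V]; a set [x : V] is identified with the class [El x] of its
    elements. *)

Inductive tree : Type := Node (T : Type) (f : T -> tree).

Fixpoint teq (s t : tree) : Prop :=
  let: Node A f := s in let: Node B g := t in
  (forall i, exists j, teq (f i) (g j)) /\
  (forall j, exists i, teq (f i) (g j)).

Lemma teq_refl : forall s, teq s s.
Proof. by elim=> T f IH; split=> i; exists i. Qed.

Lemma teq_sym : forall s t, teq s t -> teq t s.
Proof.
elim=> A f IH [B g] [h1 h2]; split=> [j|i].
- by have [i hi] := h2 j; exists i; apply: IH.
- by have [j hj] := h1 i; exists j; apply: IH.
Qed.

Lemma teq_trans : forall s t u, teq s t -> teq t u -> teq s u.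
Proof.
elim=> A f IH [B g] [C h] [h1 h2] [k1 k2]; split=> [i|k].
- by have [j hj] := h1 i; have [k hk] := k1 j; exists k; apply: IH hj hk.
- by have [j hj] := k2 k; have [i hi] := h2 j; exists i; apply: IH hi hj.
Qed.

HB.instance Definition _ := gen_eqMixin tree.
HB.instance Definition _ := gen_choiceMixin tree.

Definition teqb (s t : tree) : bool := `[< teq s t >].

Lemma teqb_equiv : equiv_class_of teqb.
Proof.
split.
- by move=> s; apply/asboolP/teq_refl.
- by move=> s t; apply/asboolP/asboolP; apply: teq_sym.
- move=> t s u /asboolP st /asboolP tu; apply/asboolP.
  exact: teq_trans st tu.
Qed.

Canonical teqb_equivRel := EquivRelPack teqb_equiv.

Definition V : Type := {eq_quot teqb_equivRel}.

HB.instance Definition _ := EqQuotient.on V.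
HB.instance Definition _ := Choice.on V.

Definition tindex (s : tree) : Type := let: Node T _ := s in T.
Definition tbranch (s : tree) : tindex s -> tree := let: Node _ f := s in f.

(* The elements of a set are indexed by a small type. *)
Definition idx (x : V) : Type := tindex (repr x).
Definition elt (x : V) (i : idx x) : V := \pi_V (tbranch i).

Definition El (x : V) : set V := range (@elt x).

Notation "x ∈ y" := (El y x) (at level 70, no associativity).

Definition emptyV : V := \pi_V (Node (fun e : False => match e with end)).
HB.instance Definition _ := isPointed.Build V emptyV.

(* The set with extension [P]; meaningful only if the class [P] is a set
   (see [El_vset]). *)
Definition vset (P : set V) : V := get [set x | El x = P].

Definition transitive_class (T : set V) : Prop := forall x, T x -> El x `<=` T.

(* By foundation, the von Neumann ordinals are the transitive sets of
   transitive sets. *)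
Definition ordinal_set (a : V) : Prop :=
  transitive_class (El a) /\ forall b, b ∈ a -> transitive_class (El b).

Definition interV (x : V) (P : set V) : V := vset (El x `&` P).

(* If the class [P] of ordinals is a set, its union is its supremum; in
   particular the supremum of the empty class is 0. *)
Definition supV (P : set V) : V := vset (\bigcup_(y in P) El y).

(* Hartogs: the set of countable ordinals, and the set of ordinals of size at
   most that of [omega1]. *)
Definition omega1 : V := vset [set a | ordinal_set a /\ countable (El a)].
Definition omega2 : V :=
  vset [set a | ordinal_set a /\ El a #<= El omega1].

Lemma pi_teq (s t : tree) : \pi_V s = \pi_V t <-> teq s t.
Proof.
split=> [/(@eqmodP _ teqb_equivRel)/asboolP //|st].
exact/(@eqmodP _ teqb_equivRel)/asboolP.
Qed.

Lemma El_pi (s : tree) :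
  El (\pi_V s) = range (fun i : tindex s => \pi_V (tbranch i)).
Proof.
rewrite /El /elt /idx.
have : teq (repr (\pi_V s)) s by apply/pi_teq; rewrite reprK.
case: (repr _) => A f; case: s => B g /= [h1 h2].
apply/seteqP; split=> [_ [i _ <-]|_ [j _ <-]].
- by have [j hj] := h1 i; exists j => //; apply/pi_teq/teq_sym.
- by have [i hi] := h2 j; exists i => //; apply/pi_teq.
Qed.

Lemma El_inj : injective El.
Proof.
move=> x y; rewrite -[x]reprK -[y]reprK !El_pi.
case: (repr x) => A f; case: (repr y) => B g /= /seteqP[h1 h2].
apply/pi_teq; split=> [i|j].
- have [|j _ /pi_teq/teq_sym hj] := h1 (\pi_V (f i)); first by exists i.
  by exists j.
- have [|i _ /pi_teq hi] := h2 (\pi_V (g j)); first by exists j.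
  by exists i.
Qed.

Lemma V_ind (P : V -> Prop) :
  (forall x, (forall y, y ∈ x -> P y) -> P x) -> forall x, P x.
Proof.
move=> IH x; rewrite -[x]reprK; elim: (repr x) => A f IHf.
by apply: IH => y; rewrite El_pi => -[i _ <-].
Qed.

Definition small (P : set V) : Prop := exists x, El x = P.

Lemma El_vset (P : set V) : small P -> El (vset P) = P.
Proof. exact: getPex. Qed.

Lemma small_El (x : V) : small (El x).
Proof. by exists x. Qed.

Lemma vset_El (x : V) : vset (El x) = x.
Proof. by apply: El_inj; apply/El_vset/small_El. Qed.

Lemma small_range (A : Type) (f : A -> V) : small (range f).
Proof.
exists (\pi_V (Node (fun i => repr (f i)))); rewrite El_pi /=.
by congr image; apply/funext => i; rewrite reprK.
Qed.

Lemma small_sub (P Q : set V) : small Q -> P `<=` Q -> small P.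
Proof.
move=> [x <-] Px.
have -> : P = range (fun i : {i : idx x | P (elt i)} => elt (sval i)).
  apply/seteqP; split=> [y Py|_ [[i Pi] _ <-] //].
  by have [i _ iy] := Px _ Py; rewrite -iy in Py *; exists (exist _ i Py).
exact: small_range.
Qed.

Lemma small_image (P : set V) (f : V -> V) : small P -> small (f @` P).
Proof.
move=> [x <-].
have -> : f @` El x = range (fun i : idx x => f (elt i)).
  apply/seteqP; split=> [_ [_ [i _ <-] <-]|_ [i _ <-]]; first by exists i.
  by exists (elt i) => //; exists i.
exact: small_range.
Qed.

Lemma small_bigcup (P : set V) (f : V -> set V) :
  small P -> (forall y, P y -> small (f y)) -> small (\bigcup_(y in P) f y).
Proof.
move=> [x <-] sf.
pose F (p : {i : idx x & idx (vset (f (elt i)))}) := elt (projT2 p).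
have -> : \bigcup_(y in El x) f y = range F.
  apply/seteqP; split=> [z [_ [i _ <-]]|_ [[i j] _ <-]].
    rewrite -(El_vset (sf _ _)); last by exists i.
    by case=> j _ <-; exists (existT _ i j).
  exists (elt i); first by exists i.
  by rewrite -(El_vset (sf _ _)); [exists j|exists i].
exact: small_range.
Qed.

Lemma El_interV (x : V) (P : set V) : El (interV x P) = El x `&` P.
Proof. by apply/El_vset/(small_sub (small_El x)) => ? []. Qed.

Lemma El_supV (P : set V) : small P -> El (supV P) = \bigcup_(y in P) El y.
Proof. by move=> sP; apply/El_vset/small_bigcup => // y _; apply: small_El. Qed.

(* An ordinal injecting into [T] is determined by the range of the injection
   and the relation induced there. *)
Lemma small_hartogs (T : Type) :
  small [set a | ordinal_set a /\ El a #<= [set: T]].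
Proof.
pose code (p : (T -> Prop) * (T -> T -> Prop)) (a : V) := ordinal_set a /\
  exists f : {x | x ∈ a} -> T, p.1 = range f /\
    forall x y, p.2 (f x) (f y) <-> sval x ∈ sval y.
have code_eq p a b : code p a -> code p b -> forall x (xa : x ∈ a) y,
    forall (yb : y ∈ b),
    forall f : {x | x ∈ a} -> T, p.1 = range f ->
    (forall x y, p.2 (f x) (f y) <-> sval x ∈ sval y) ->
    forall g : {x | x ∈ b} -> T, p.1 = range g ->
    (forall x y, p.2 (g x) (g y) <-> sval x ∈ sval y) ->
    f (exist _ x xa) = g (exist _ y yb) -> x = y.
  move=> [[ta _] _] [[tb _] _]; elim/V_ind => x IH xa y yb f pf rf g pg rg fg.
  apply: El_inj; apply/seteqP; split=> z.
    move=> zx; have za := ta _ xa _ zx.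
    have : range g (f (exist _ z za)) by rewrite -pg pf; exists (exist _ z za).
    move=> [[w wb] _ gw].
    have := rg (exist _ w wb) (exist _ y yb).
    rewrite gw -fg rf /= => -[/(_ zx) wy _].
    by rewrite (IH z zx za w wb f pf rf g pg rg (esym gw)).
  move=> zy; have zb := tb _ yb _ zy.
  have : range f (g (exist _ z zb)) by rewrite -pf pg; exists (exist _ z zb).
  move=> [[w wa] _ fw].
  have := rf (exist _ w wa) (exist _ x xa).
  rewrite fw fg rg /= => -[/(_ zy) wx _].
  by rewrite -(IH w wx wa z zb f pf rf g pg rg fw).
have code_sub p a b : code p a -> code p b -> El a `<=` El b.
  move=> ca cb x xa.
  have [[_ [f [pf rf]]] [_ [g [pg rg]]]] := (ca, cb).
  have : range g (f (exist _ x xa)) by rewrite -pg pf; exists (exist _ x xa).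
  by move=> [[y yb] _ gy]; rewrite (code_eq p a b ca cb x xa y yb f _ _ g).
apply: (small_sub (small_range (fun p => get (code p)))) => a [oa].
move=> /card_leP[f].
pose h (x : {x | x ∈ a}) : T := val (f (SigSub (mem_set (svalP x)))).
have hinj : injective h.
  move=> [x xa] [y ya] /val_inj/(inj (in_setT _) (in_setT _)) [xy].
  by subst y; congr exist; apply: Prop_irrelevance.
pose R t u := exists x y, [/\ t = h x, u = h y & sval x ∈ sval y].
have ca : code (range h, R) a.
  split=> //; exists h; split=> // x y; split=> [|xy]; last by exists x, y.
  by move=> [x' [y' [/hinj-> /hinj->]]].
exists (range h, R) => //.
have cg : code (range h, R) (get (code (range h, R))) by apply: getPex; exists a.
by apply: El_inj; apply/seteqP; split; [apply: code_sub cg ca|apply: code_sub ca cg].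
Qed.

Lemma El_omega1 : El omega1 = [set a | ordinal_set a /\ countable (El a)].
Proof. exact/El_vset/small_hartogs. Qed.

Lemma El_omega2 : El omega2 = [set a | ordinal_set a /\ El a #<= El omega1].
Proof.
apply/El_vset/(small_sub (small_hartogs (idx omega1))) => a [oa le].
by split=> //; apply: card_le_trans le (card_image_le _ _).
Qed.

Definition trcl (x : V) : set V := smallest transitive_class (El x).

(* H(omega_2): a transitive closure of size less than omega_2 is one of size
   at most omega_1. *)
Definition Homega2 : set V := [set x | trcl x #<= El omega1].

Definition countable_subsets (x : V) : set V :=
  [set a | El a `<=` El x /\ countable (El a)].

(* The order on ordinals is inclusion. *)
Definition is_least (P : set V) (b : V) : Prop :=
  P b /\ forall c, P c -> El b `<=` El c.
Definition is_largest (P : set V) (b : V) : Prop :=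
  P b /\ forall c, P c -> El c `<=` El b.

Definition limit_point (D : set V) (d : V) : Prop :=
  d <> emptyV /\ supV (D `&` El d) = d.

Definition club (k : V) (D : set V) : Prop :=
  [/\ D `<=` El k,
      forall a, a ∈ k -> exists2 b, D b & a ∈ b
    & forall d, d ∈ k -> limit_point D d -> D d].

Definition stationary (k : V) (S : set V) : Prop :=
  S `<=` El k /\ forall D, club k D -> S `&` D !=set0.

Definition club_countable (x : V) (D : set V) : Prop :=
  [/\ D `<=` countable_subsets x,
      forall a, countable_subsets x a -> exists2 c, D c & El a `<=` El c
    & forall u : nat -> V, (forall n, D (u n)) ->
        (forall n, El (u n) `<=` El (u n.+1)) -> D (vset (\bigcup_n El (u n)))].

Definition stationary_countable (x : V) (S : set V) : Prop :=
  S `<=` countable_subsets x /\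
  forall D, club_countable x D -> S `&` D !=set0.

Definition cofinal_map (a b : V) : Prop :=
  exists f : V -> V, (forall x, x ∈ a -> f x ∈ b) /\
    forall y, y ∈ b -> exists2 x, x ∈ a & El y `<=` El (f x).

Definition cofinality (b a : V) : Prop :=
  is_least [set c | ordinal_set c /\ cofinal_map c b] a.

Definition thin (Y : set V) : Prop :=
  forall b, b ∈ omega2 ->
    [set interV a (El b) | a in Y] #<= El omega1.

Definition closed_initial_segments (Y : set V) : Prop :=
  forall a b, Y a -> b ∈ omega2 -> Y (interV a (El b)).

(* Formulas for the structure (H(omega_2), ∈, pi, Y) with free variables among
   [n] variables.  The function pi is only defined on omega_2, so it enters as
   the binary relation given by its graph.  [fEx] binds variable 0. *)
Inductive form (n : nat) : Type :=
| fMem (i j : 'I_n)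
| fEq (i j : 'I_n)
| fPi (i j : 'I_n)
| fY (i : 'I_n)
| fNot (phi : form n)
| fAnd (phi psi : form n)
| fEx (phi : form n.+1).

Definition scons (n : nat) (x : V) (e : 'I_n -> V) (i : 'I_n.+1) : V :=
  if unlift ord0 i is Some j then e j else x.

Fixpoint sat (pi : V -> V) (Y : set V) (n : nat) (phi : form n)
    (e : 'I_n -> V) : Prop :=
  match phi in form _ return Prop with
  | fMem i j => e i ∈ e j
  | fEq i j => e i = e j
  | fPi i j => e i ∈ omega2 /\ pi (e i) = e j
  | fY i => Y (e i)
  | fNot phi => ~ sat pi Y phi e
  | fAnd phi psi => sat pi Y phi e /\ sat pi Y psi e
  | fEx phi => exists2 x, Homega2 x & sat pi Y phi (scons x e)
  end.

Definition in_domain (n : nat) (e : 'I_n -> V) : Prop := forall i, Homega2 (e i).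

Definition definable_function (pi : V -> V) (Y : set V) (n : nat)
    (f : ('I_n -> V) -> V) : Prop :=
  (forall e, in_domain e -> Homega2 (f e)) /\
  exists psi : form n.+1, forall e x, in_domain e -> Homega2 x ->
    (sat pi Y psi (scons x e) <-> x = f e).

Definition skolem_function (pi : V -> V) (Y : set V) (n : nat)
    (phi : form n.+1) (f : ('I_n -> V) -> V) : Prop :=
  forall e, in_domain e ->
    (exists2 x, Homega2 x & sat pi Y phi (scons x e)) ->
    sat pi Y phi (scons (f e) e).

(* [F n] is the set of [n]-ary functions of the family [F]. *)
Definition definable_skolem_functions (pi : V -> V) (Y : set V)
    (F : forall n, set (('I_n -> V) -> V)) : Prop :=
  (forall n f, F n f -> definable_function pi Y f) /\
  (forall n (phi : form n.+1), exists2 f, F n f & skolem_function pi Y phi f).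

Definition closed_under (F : forall n, set (('I_n -> V) -> V)) (S : set V) :
    Prop :=
  forall n f (e : 'I_n -> V), F n f -> (forall i, S (e i)) -> S (f e).

Definition Sk (F : forall n, set (('I_n -> V) -> V)) (a : set V) : set V :=
  smallest (closed_under F) a.

Definition clubC (F : forall n, set (('I_n -> V) -> V)) : set V :=
  [set b | b ∈ omega2 /\ Sk F (El b) `&` El omega2 = El b].

Definition Lambda (F : forall n, set (('I_n -> V) -> V)) : set V :=
  [set b | [/\ b ∈ omega2, cofinality b omega1 & limit_point (clubC F) b]].

Definition models (F : forall n, set (('I_n -> V) -> V)) (Y : set V) : set V :=
  [set M | [/\ Y M, Sk F (El M) `&` El omega2 = El M
    & forall g, g ∈ M -> supV (clubC F `&` El g) ∈ M]].

Definition Gamma_at (Gamma : set V) (M : V) : set V :=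
  [set b | Gamma b /\
    is_least (Gamma `\` El (supV (El M `&` El b))) b].

(* The intersection has exactly one largest element, so [get] returns it. *)
Definition comparison_point (Gamma : set V) (M N : V) : V :=
  get (is_largest (Gamma_at Gamma M `&` Gamma_at Gamma N)).

Definition adequate (F : forall n, set (('I_n -> V) -> V)) (Y Gamma : set V)
    (A : set V) : Prop :=
  A `<=` models F Y /\
  forall M N, A M -> A N ->
    let b := comparison_point Gamma M N in
    [\/ interV M (El b) = interV N (El b),
        Sk F (El N) (interV M (El b))
      | Sk F (El M) (interV N (El b))].

Definition closed_for (F : forall n, set (('I_n -> V) -> V)) (Gamma : set V)
    (N : V) (A : set V) : Prop :=
  forall M, A M ->
    let b := comparison_point Gamma M N in
    Sk F (El N) (interV M (El b)) -> A (interV M (El b)).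

(* Main.v *)
(** Let [L] be in [B], [M] in [A] and [b] their comparison point.  Since [L] is
    a subset of [N], the comparison point of [M] and [N] is at least [b].  By
    thinness and the closure of [b] under Skolem functions, the segment of [L]
    below [b] is [pi x] for some [x] below [b], and [x] is in [N].  If below
    their comparison point [M] and [N] agree, or the segment of [N] is in
    [Sk M], then [x] is in [M], so the segment of [L] is in [Sk M].  Otherwise
    [N]-closure puts the segment of [M] into [A] and [Sk N], hence into [B],
    and its comparison with [L] restricts to [b]. *)

Require Import Defs.
From mathcomp Require Import all_boot.
From mathcomp Require Import all_classical.
Set Implicit Arguments.
Unset Strict Implicit.
Unset Printing Implicit Defensive.
Local Open Scope classical_set_scope.
Local Open Scope card_scope.

(** * Injections and countable sets *)

Lemma card_le_inj (T : Type) (U : pointedType) (A : set T) (B : set U) :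
  A #<= B <-> exists f : T -> U, (forall x, A x -> B (f x)) /\
    (forall x y, A x -> A y -> f x = f y -> x = y).
Proof.
split=> [/pcard_leP[f]|[f [fB fI]]].
  exists f; split=> [x Ax|x y Ax Ay]; first exact: funS.
  by apply: inj; rewrite inE.
rewrite -(card_le_eql (inj_card_eq (f := f) (A := A) _)).
  by apply: subset_card_le => _ [x Ax <-]; apply: fB.
by move=> x y; rewrite !inE; apply: fI.
Qed.

Lemma countable_range (T : Type) (f : nat -> T) : countable (range f).
Proof. exact: card_image_le. Qed.

Lemma countable_enum (A : set V) : countable A -> A !=set0 ->
  exists e : nat -> V, A = range e.
Proof.
move=> /pfcard_geP[->|[e] _]; first by case.
exists e; apply/seteqP; split=> [x Ax|_ [n _ <-]]; last exact: funS.
by have [n _ <-] := @surj _ _ _ _ e _ Ax; exists n.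
Qed.

Lemma countable_setU (T : Type) (A B : set T) :
  countable A -> countable B -> countable (A `|` B).
Proof.
move=> cA cB.
have -> : A `|` B = \bigcup_(b in [set: bool]) (if b then A else B).
  apply/seteqP; split=> [x [Ax|Bx]|x [[] _]]; first by exists true.
  - by exists false.
  - by left.
  - by right.
by apply: bigcup_countable => // -[].
Qed.

(** * Ordinals *)

Lemma in_irrefl (x : V) : ~ x ∈ x.
Proof. by elim/V_ind: x => x IH xx; apply: IH (xx) (xx). Qed.

Lemma exists_in_minimal (P : set V) : P !=set0 ->
  exists2 x, P x & forall y, y ∈ x -> ~ P y.
Proof.
move=> [x Px]; apply: contrapT => none.
elim/V_ind: x Px => x IH Px; apply: none; exists x => // y /IH; exact.
Qed.

Lemma El_emptyV : El emptyV = set0.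
Proof. by rewrite /emptyV El_pi; apply/seteqP; split=> x // [[]]. Qed.

Lemma small_set1 (x : V) : small [set x].
Proof.
have -> : [set x] = range (fun _ : unit => x).
  by apply/seteqP; split=> [_ ->|_ [_ _ <-]//]; exists tt.
exact: small_range.
Qed.

Lemma small_setU (P Q : set V) : small P -> small Q -> small (P `|` Q).
Proof.
move=> [x <-] [y <-].
pose f (i : idx x + idx y) := match i with inl i => elt i | inr j => elt j end.
have -> : El x `|` El y = range f.
  apply/seteqP; split=> [_ [[i _ <-]|[i _ <-]]|_ [[i|i] _ <-]].
  - by exists (inl i).
  - by exists (inr i).
  - by left; exists i.
  - by right; exists i.
exact: small_range.
Qed.

Definition succV (x : V) : V := vset (El x `|` [set x]).

Lemma El_succV (x : V) : El (succV x) = El x `|` [set x].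
Proof. by apply/El_vset/small_setU; [apply: small_El|apply: small_set1]. Qed.

Lemma in_succV (x : V) : x ∈ succV x.
Proof. by rewrite El_succV; right. Qed.

Definition pairV (x y : V) : V := vset [set x; y].

Lemma El_pairV (x y : V) : El (pairV x y) = [set x; y].
Proof. by apply/El_vset/small_setU; apply: small_set1. Qed.

Lemma ordinal_in (a b : V) : ordinal_set a -> b ∈ a -> ordinal_set b.
Proof. by move=> [ta eta] ba; split; [exact: eta|move=> c /(ta _ ba)/eta]. Qed.

Lemma ordinal_trans (a b c : V) :
  ordinal_set a -> b ∈ a -> c ∈ b -> c ∈ a.
Proof. by move=> [ta _] ba; apply: ta. Qed.

Lemma ordinal_total (a b : V) : ordinal_set a -> ordinal_set b ->
  [\/ a = b, a ∈ b | b ∈ a].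
Proof.
elim/V_ind: a b => a IHa; elim/V_ind => b IHb oa ob.
have [|nab] := pselect (a ∈ b); first by constructor 2.
have [|nba] := pselect (b ∈ a); first by constructor 3.
constructor 1; apply: El_inj; apply/seteqP; split=> [x xa|y yb].
- have [xb|//|bx] := IHa x xa b (ordinal_in oa xa) ob.
    by rewrite -xb in nba.
  by case: nba; apply: ordinal_trans bx.
- have [ay|ay|//] := IHb y yb oa (ordinal_in ob yb).
    by rewrite ay in nab.
  by case: nab; apply: ordinal_trans ay.
Qed.

Lemma ordinal_in_or_sub (a b : V) : ordinal_set a -> ordinal_set b ->
  a ∈ b \/ El b `<=` El a.
Proof.
move=> oa ob; have [->|ab|ba] := ordinal_total oa ob; [by right|by left|].
by right=> x; apply: ordinal_trans ba.
Qed.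

Lemma ordinal_sub_in (a b : V) : ordinal_set a -> b ∈ a -> El b `<=` El a.
Proof. by move=> oa ba x; apply: ordinal_trans ba. Qed.

Lemma ordinal_succV (a : V) : ordinal_set a -> ordinal_set (succV a).
Proof.
move=> oa; split=> b; rewrite El_succV => -[ba|->] c.
- by move=> cb; left; apply: ordinal_trans cb.
- by left.
- by case: (ordinal_in oa ba) => + _; apply.
- by case: oa => + _; apply.
Qed.

Lemma succV_inj (a b : V) : ordinal_set a -> ordinal_set b ->
  succV a = succV b -> a = b.
Proof.
move=> oa ob ab; have := in_succV a; rewrite ab El_succV => -[aib|//].
have := in_succV b; rewrite -ab El_succV => -[bia|//].
by case: (@in_irrefl a); apply: ordinal_trans bia aib.
Qed.

Lemma exists_least_ordinal (P : set V) :
  (forall x, P x -> ordinal_set x) -> P !=set0 -> exists b, is_least P b.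
Proof.
move=> oP /exists_in_minimal[b Pb bmin]; exists b; split=> // c Pc.
have [cb|//] := ordinal_in_or_sub (oP _ Pc) (oP _ Pb).
by case: (bmin c cb).
Qed.

Lemma omega1_ordinal (a : V) : a ∈ omega1 -> ordinal_set a.
Proof. by rewrite El_omega1 => -[]. Qed.

Lemma omega2_ordinal (a : V) : a ∈ omega2 -> ordinal_set a.
Proof. by rewrite El_omega2 => -[]. Qed.

Lemma omega2_card (a : V) : a ∈ omega2 -> El a #<= El omega1.
Proof. by rewrite El_omega2 => -[]. Qed.

Lemma omega1_trans : transitive_class (El omega1).
Proof.
move=> a; rewrite El_omega1 => -[oa ca] b ba; split.
  exact: ordinal_in ba.
apply: sub_countable ca; apply: subset_card_le; exact: ordinal_sub_in.
Qed.

Lemma omega2_trans : transitive_class (El omega2).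
Proof.
move=> a; rewrite El_omega2 => -[oa ca] b ba; split.
  exact: ordinal_in ba.
apply: card_le_trans ca; apply: subset_card_le; exact: ordinal_sub_in.
Qed.

Lemma ordinal_omega1 : ordinal_set omega1.
Proof.
by split; [exact: omega1_trans|move=> b /omega1_ordinal[]].
Qed.

(** If [omega1] were countable, it would be one of its own elements. *)
Lemma omega1_uncountable : ~ countable (El omega1).
Proof.
move=> cw; apply: (@in_irrefl omega1); rewrite El_omega1; split=> //.
exact: ordinal_omega1.
Qed.

Lemma succV_omega1 (a : V) : a ∈ omega1 -> succV a ∈ omega1.
Proof.
rewrite El_omega1 => -[oa ca]; split; first exact: ordinal_succV.
by rewrite El_succV; apply: countable_setU.
Qed.

Lemma emptyV_omega1 : emptyV ∈ omega1.
Proof. by rewrite El_omega1; split; [split=> x|]; rewrite El_emptyV. Qed.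

Lemma succV_neq0 (a : V) : succV a <> emptyV.
Proof. by move=> /(congr1 El); rewrite El_emptyV => h; have := in_succV a; rewrite h. Qed.

Fixpoint natV (n : nat) : V := if n is n'.+1 then succV (natV n') else emptyV.

Lemma natV_omega1 (n : nat) : natV n ∈ omega1.
Proof. by elim: n => [|n IH] /=; [apply: emptyV_omega1|apply: succV_omega1]. Qed.

Lemma natV_inj : injective natV.
Proof.
elim=> [|n IH] [|m] //= => [/esym/succV_neq0//|/succV_neq0//|h].
by congr S; apply: IH; apply: succV_inj h; apply/omega1_ordinal/natV_omega1.
Qed.

Definition omegaV : V := vset (range natV).

Lemma El_omegaV : El omegaV = range natV.
Proof. exact/El_vset/small_range. Qed.

Lemma natV_sub (n : nat) : El (natV n) `<=` range natV.
Proof.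
elim: n => [|n IH] /=; first by rewrite El_emptyV.
by rewrite El_succV => x [/IH//|->]; exists n.
Qed.

Lemma ordinal_omegaV : ordinal_set omegaV.
Proof.
split=> b; rewrite El_omegaV => -[n _ <-]; first exact: natV_sub.
by case: (omega1_ordinal (natV_omega1 n)).
Qed.

(* Hilbert's hotel: the copy of omega in [omega1] absorbs a countable set. *)
Lemma card_setU_countable (A B : set V) : A #<= El omega1 -> countable B ->
  A `|` B #<= El omega1.
Proof.
move=> /card_le_inj[f [fA fI]] /countable_injP[g gI].
(* [h] doubles the natural numbers and fixes everything else, which leaves the odd natural numbers
   free for [B]. *)
pose h (x : V) : V := if pselect (exists n, x = natV n) is left e
  then natV (projT1 (cid e)).*2 else x.
have hw x : x ∈ omega1 -> h x ∈ omega1.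
  by rewrite /h; case: pselect => // e _; apply: natV_omega1.
have hI x y : h x = h y -> x = y.
  rewrite /h; case: pselect => [e|ne]; case: pselect => [e'|ne'].
  - move=> /natV_inj/double_inj E; case: (cid e) E => /= n ->.
    by case: (cid e') => /= m -> ->.
  - by move=> E; case: ne'; rewrite -E; eexists.
  - by move=> E; case: ne; rewrite E; eexists.
  - by [].
have hn x n : h x <> natV n.*2.+1.
  rewrite /h; case: pselect => [e|ne].
    by move/natV_inj/(congr1 odd); rewrite /= !odd_double.
  by move=> E; apply: ne; eexists; exact: E.
apply/card_le_inj.
exists (fun x => if pselect (A x) is left _ then h (f x) else natV (g x).*2.+1); split.
  move=> x ABx; case: pselect => [Ax|nAx]; [exact/hw/fA|exact: (natV_omega1 _.+1)].
move=> x y ABx ABy; case: pselect => [Ax|nAx]; case: pselect => [Ay|nAy].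
- by move/hI/fI; apply.
- by move/hn.
- by move/esym/hn.
- case: ABx => // Bx; case: ABy => // By.
  by move/natV_inj=> -[] /double_inj; apply: gI; rewrite inE.
Qed.

Lemma succV_omega2 (a : V) : a ∈ omega2 -> succV a ∈ omega2.
Proof.
rewrite El_omega2 => -[oa ca]; split; first exact: ordinal_succV.
by rewrite El_succV; apply: card_setU_countable.
Qed.

(** An enumeration of an unbounded countable [T] would be a cofinal map from omega to [b].
    Minimality of the cofinality would then make [omega1] a subset of omega. *)
Lemma bounded_cofinality_omega1 (b : V) (T : set V) :
  ordinal_set b -> b <> emptyV -> cofinality b omega1 ->
  T `<=` El b -> countable T -> exists2 c, c ∈ b & T `<=` El c.
Proof.
move=> ob b0 [_ cofb] Tb cT; apply: contrapT => unb.
have ub c : c ∈ b -> exists2 t, T t & El c `<=` El t.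
  move=> cb; apply: contrapT => h; apply: unb; exists c => // t Tt.
  have [//|ct] := ordinal_in_or_sub (ordinal_in ob (Tb _ Tt)) (ordinal_in ob cb).
  by case: h; exists t.
have [c cb] : El b !=set0.
  apply/set0P/negP => /eqP h; apply: b0; apply: El_inj; by rewrite h El_emptyV.
have [t Tt _] := ub c cb.
have [e eT] := countable_enum cT (ex_intro _ t Tt).
apply: omega1_uncountable; apply: sub_countable (countable_range natV).
apply: subset_card_le; rewrite -El_omegaV; apply: cofb; split.
  exact: ordinal_omegaV.
(* The enumeration is transported along [natV]; the value [t] outside omega is arbitrary. *)
pose f x := if pselect (exists n, x = natV n) is left h
  then e (projT1 (cid h)) else t.
have fn n : f (natV n) = e n.
  rewrite /f; case: pselect => [h|]; last by case; exists n.
  by case: (cid h) => m /= /natV_inj ->.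
exists f; split=> [x|y yb].
  by rewrite El_omegaV => -[n _ <-]; rewrite fn; apply: Tb; rewrite eT; exists n.
have [u] := ub y yb; rewrite eT => -[n _ <-] yu.
by exists (natV n); rewrite ?fn// El_omegaV; exists n.
Qed.

(** * Bounded subsets of omega2 and comparison points *)

Lemma Lambda_omega2 F (b : V) : Lambda F b -> b ∈ omega2.
Proof. by case. Qed.

Lemma Lambda_bounded F (b : V) (T : set V) : Lambda F b ->
  T `<=` El b -> countable T -> exists2 c, c ∈ b & T `<=` El c.
Proof.
move=> [b2 cofb [b0 _]]; apply: bounded_cofinality_omega1 => //.
exact: omega2_ordinal.
Qed.

Lemma supV_sub_in (D : set V) (d x : V) :
  supV (D `&` El d) = d -> x ∈ d -> exists e, [/\ D e, e ∈ d & x ∈ e].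
Proof.
move=> dE; rewrite -{1}dE El_supV; first by move=> [e [De ed] xe]; exists e.
by apply: small_sub (small_El d) _ => ? [].
Qed.

(* If [S] were unbounded, then its initial unions along an enumeration in
   type [omega1] would form a club of points of countable cofinality, which
   misses [Gamma]. *)
Lemma omega2_bounded F (Gamma S : set V) :
  Gamma `<=` Lambda F -> stationary omega2 Gamma ->
  S `<=` El omega2 -> S #<= El omega1 ->
  exists2 d, d ∈ omega2 & S `<=` El d.
Proof.
move=> GL [_ Gst] S2 /card_le_inj[f [f1 fI]]; apply: contrapT => unb.
(* Among the elements of [S] not below [d], take the one with the least index under [f]; everything
   enumerated before it lies below [d]. *)
have ub d : d ∈ omega2 -> exists s, [/\ S s, El d `<=` El s &
    forall t, S t -> f t ∈ f s -> t ∈ d].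
  move=> d2.
  have [|x [s Ss [xE ds]] xmin] := @exists_in_minimal
      [set x | exists2 s, S s & x = f s /\ El d `<=` El s].
    apply: contrapT => h; apply: unb; exists d => // s Ss.
    have [//|ds] := ordinal_in_or_sub (omega2_ordinal (S2 _ Ss)) (omega2_ordinal d2).
    by case: h; exists (f s), s.
  exists s; split=> // t St; rewrite -xE => tx.
  have [//|dt] := ordinal_in_or_sub (omega2_ordinal (S2 _ St)) (omega2_ordinal d2).
  by case: (xmin _ tx); exists t.
(* The successor makes each enumerated [s] itself an element of the union. *)
pose H a := \bigcup_(s in S `&` [set s | f s ∈ a]) El (succV s).
pose D := [set d | d ∈ omega2 /\ exists2 a, a ∈ omega1 & El d = H a].
have H_sub a a' : El a `<=` El a' -> H a `<=` H a'.
  by move=> aa' x [s [Ss sa] xs]; exists s => //; split=> //; apply: aa'.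
have Dclub : club omega2 D.
  split=> [d []//|a a2|d d2 [d0 dE]].
  - have [s [Ss as_ smin]] := ub _ a2.
    (* All elements enumerated before [s] lie below [a], hence in [s], so the union up to and
       including [s] is exactly [succV s]. *)
    exists (succV s); last first.
      rewrite El_succV.
      have [|sa] := ordinal_in_or_sub (omega2_ordinal a2) (omega2_ordinal (S2 _ Ss)).
        by left.
      by right; apply: El_inj; apply/seteqP.
    split; first exact/succV_omega2/S2.
    exists (succV (f s)); first exact/succV_omega1/f1.
    apply/seteqP; split=> [x xs|x [t [St]]].
      by exists s => //; split=> //; apply: in_succV.
    rewrite /= El_succV => -[fts|/fI -> //].
    rewrite !El_succV => -[xt|->]; left.
      apply: (ordinal_trans (omega2_ordinal (S2 _ Ss)) _ xt).
      exact/as_/smin.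
    exact/as_/smin.
  (* A limit [d] is the union up to the index of the first [s] not below [d]: a point of [D] below
     [d] with a larger index would contain [s], although [s] is not below [d]. *)
  - have [s [Ss ds smin]] := ub _ d2.
    split=> //; exists (f s); first exact: f1.
    apply/seteqP; split=> [x xd|x [t [St ts]]].
      have [e [[e2 [a a1 eE]] ed xe]] := supV_sub_in dE xd.
      have [sa|as_] := ordinal_in_or_sub (omega1_ordinal (f1 _ Ss)) (omega1_ordinal a1).
        have se : s ∈ e.
          by rewrite eE; exists s; [split|apply: in_succV].
        case: (@in_irrefl s); apply: ds; exact: ordinal_trans (omega2_ordinal d2) ed se.
      by apply: (H_sub a) => //; rewrite -eE.
    rewrite El_succV => -[xt|->]; last exact: smin.
    exact: ordinal_trans (omega2_ordinal d2) (smin _ St ts) xt.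
have [b [/GL Lb [b2 [a a1 bE]]]] := Gst _ Dclub.
(* The index [a] is countable, so only countably many elements of [S] are used, and these are
   cofinal in [b], against its cofinality [omega1]. *)
have [||c cb Tc] := @Lambda_bounded F b (S `&` [set s | f s ∈ a]) Lb.
- by move=> s [Ss sa]; rewrite bE; exists s => //; apply: in_succV.
- move: a1; rewrite El_omega1 => -[_ ca]; apply: card_le_trans ca.
  by apply/card_le_inj; exists f; split=> [s [_ sa]//|s t [Ss _] [St _]]; apply: fI.
case: (@in_irrefl c); move: (cb); rewrite {1}bE => -[s sa].
rewrite El_succV => -[cs|cs]; last by have := Tc _ sa; rewrite -cs.
have oc := ordinal_in (omega2_ordinal b2) cb.
exact: ordinal_trans oc (Tc _ sa) cs.
Qed.

(** The ordinals above [d] form a club, which a stationary set meets. *)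
Lemma Gamma_unbounded (Gamma : set V) (d : V) : stationary omega2 Gamma ->
  d ∈ omega2 -> exists2 b, Gamma b & d ∈ b.
Proof.
move=> [_ Gst] d2.
have [|b [Gb [_ db]]] := Gst [set b | b ∈ omega2 /\ d ∈ b]; last by exists b.
split=> [b []//|a a2|b b2 [b0 bE]].
- have [da|ad] := ordinal_in_or_sub (omega2_ordinal d2) (omega2_ordinal a2).
    exists (succV a); last exact: in_succV.
    by split; [exact: succV_omega2|rewrite El_succV; left].
  exists (succV d); first by split; [exact: succV_omega2|exact: in_succV].
  rewrite El_succV.
  have [|da] := ordinal_in_or_sub (omega2_ordinal a2) (omega2_ordinal d2).
    by left.
  by right; apply: El_inj; apply/seteqP.
- split=> //.
  have [x xb] : El b !=set0.
    apply/set0P/negP => /eqP h; apply: b0; apply: El_inj.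
    by rewrite h El_emptyV.
  have [e [[_ de] eb _]] := supV_sub_in bE xb.
  exact: ordinal_trans (omega2_ordinal b2) eb de.
Qed.

Lemma El_supI (M b : V) : El (supV (El M `&` El b)) =
  \bigcup_(m in El M `&` El b) El m.
Proof. by rewrite El_supV//; apply: small_sub (small_El M) _ => ? []. Qed.

(** Removes the supremum, so that the effect of enlarging or cutting [M] on its points of [Gamma]
    can be read off. *)
Lemma Gamma_atP (Gamma : set V) (M b : V) : Gamma `<=` El omega2 ->
  Gamma_at Gamma M b <-> Gamma b /\
    forall c, Gamma c -> c ∈ b -> exists m, [/\ m ∈ M, m ∈ b & c ∈ m].
Proof.
move=> G2; split=> -[Gb h]; split=> //.
  move=> c Gc cb; case: h => _ bmin.
  have [|nc] := pselect (c ∈ supV (El M `&` El b)).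
    by rewrite El_supI => -[m [mM mb] cm]; exists m.
  by case: (@in_irrefl c); apply: (bmin c).
split=> [|c [Gc nc]].
  split=> //; rewrite El_supI => -[m [_ mb] bm]; case: (@in_irrefl b).
  exact: ordinal_trans (omega2_ordinal (G2 _ Gb)) mb bm.
have [cb|//] := ordinal_in_or_sub (omega2_ordinal (G2 _ Gc)) (omega2_ordinal (G2 _ Gb)).
case: nc; rewrite El_supI; have [m [mM mb cm]] := h c Gc cb.
by exists m.
Qed.

(* A supremum of points of [Gamma_M] and [Gamma_N] is also a supremum of points
   of [M] and of points of [N], so the first point of [Gamma] above it belongs
   to both. *)
Lemma comparison_point_exists F (Gamma : set V) (M N : V) :
  Gamma `<=` Lambda F -> stationary omega2 Gamma ->
  El M `<=` El omega2 -> countable (El M) ->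
  Gamma_at Gamma M `&` Gamma_at Gamma N !=set0 ->
  exists b, is_largest (Gamma_at Gamma M `&` Gamma_at Gamma N) b.
Proof.
set G := _ `&` _ => GL Gst M2 cM [b0 Gb0].
have G2 : Gamma `<=` El omega2 by move=> b /GL/Lambda_omega2.
have [|d d2 Md] := omega2_bounded GL Gst M2.
  apply: card_le_trans cM _; apply/card_le_inj; exists natV.
  by split=> [n _|n m _ _ /natV_inj//]; apply: natV_omega1.
have [b1 Gb1 db1] := Gamma_unbounded Gst d2.
(* A point of [G] beyond [b1] would require an element of [M] above [b1], hence above the bound [d]
   of [M]. *)
have Gb1_sub b : G b -> El b `<=` El b1.
  move=> [/(Gamma_atP _ _ G2)[Gb hb] _].
  have [b1b|//] := ordinal_in_or_sub (omega2_ordinal (G2 _ Gb1)) (omega2_ordinal (G2 _ Gb)).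
  have [m [/Md md _ b1m]] := hb b1 Gb1 b1b.
  case: (@in_irrefl d).
  have od := omega2_ordinal d2.
  exact: (ordinal_trans od md (ordinal_trans (ordinal_in od md) b1m db1)).
have GG b : G b -> Gamma b by move=> [/(Gamma_atP _ _ G2)[]].
have oG b : G b -> ordinal_set b by move/GG/G2/omega2_ordinal.
have sG : small G by apply: (small_sub (small_El omega2)) => b /GG/G2.
apply: contrapT => none.
have Gnext b : G b -> exists2 b', G b' & b ∈ b'.
  move=> Gb; apply: contrapT => h; apply: none; exists b; split=> // c Gc.
  have [bc|//] := ordinal_in_or_sub (oG _ Gb) (oG _ Gc).
  by case: h; exists c.
(* [b] is the first point of [Gamma] at or above the supremum of [G]. It turns out to be in [G], so
   by [Gnext] it cannot bound [G]. *)
have [||b [[Gb nb] bmin]] := @exists_least_ordinal (Gamma `\` El (supV G)).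
- by move=> x [/G2/omega2_ordinal].
- exists b1; split=> //; rewrite El_supV// => -[c Gc b1c].
  by case: (@in_irrefl b1); exact: Gb1_sub Gc _ b1c.
have sub_b c : G c -> El c `<=` El b.
  move=> Gc; have [bc|//] := ordinal_in_or_sub (omega2_ordinal (G2 _ Gb)) (oG _ Gc).
  by case: nb; rewrite El_supV//; exists c.
have inb c : Gamma c -> c ∈ b -> exists2 c', G c' & c ∈ c'.
  move=> Gc cb; have [|nc] := pselect (c ∈ supV G).
    by rewrite El_supV// => -[c' Gc' cc']; exists c'.
  by case: (@in_irrefl c); apply: (bmin c).
suff [c Gc bc] : exists2 c, G c & b ∈ c by case: (@in_irrefl b); apply: sub_b Gc _ bc.
apply: Gnext; split; apply/Gamma_atP => //; split=> // c Gc /(inb _ Gc)[c' Gc' cc'].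
- have [/(Gamma_atP _ _ G2)[_ h] _] := Gc'.
  by have [m [mM mc' cm]] := h c Gc cc'; exists m; split=> //; apply: sub_b Gc' _ mc'.
- have [_ /(Gamma_atP _ _ G2)[_ h]] := Gc'.
  by have [m [mM mc' cm]] := h c Gc cc'; exists m; split=> //; apply: sub_b Gc' _ mc'.
Qed.

Lemma comparison_pointC (Gamma : set V) (M N : V) :
  comparison_point Gamma M N = comparison_point Gamma N M.
Proof. by rewrite /comparison_point setIC. Qed.

Lemma comparison_pointP F (Gamma : set V) (M N b : V) :
  Gamma `<=` Lambda F -> stationary omega2 Gamma ->
  El M `<=` El omega2 -> countable (El M) ->
  Gamma_at Gamma M b -> Gamma_at Gamma N b ->
  is_largest (Gamma_at Gamma M `&` Gamma_at Gamma N) (comparison_point Gamma M N).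
Proof.
move=> GL Gst M2 cM Mb Nb; apply: getPex.
by apply: comparison_point_exists GL Gst M2 cM _; exists b.
Qed.

(** * Skolem hulls *)

Lemma trcl_trans (x : V) : transitive_class (trcl x).
Proof. by move=> y ty z zy T [tT xT]; apply: (tT y) => //; apply: ty. Qed.

Lemma sub_trcl (x : V) : El x `<=` trcl x.
Proof. exact: sub_gen_smallest. Qed.

Lemma trcl_sub (x : V) (T : set V) :
  transitive_class T -> El x `<=` T -> trcl x `<=` T.
Proof. by move=> tT xT; apply: smallest_sub. Qed.

Lemma trcl_in (x y : V) : y ∈ x -> trcl y `<=` trcl x.
Proof.
move=> yx; apply: trcl_sub; first exact: trcl_trans.
by apply: trcl_trans; apply: sub_trcl.
Qed.

(** Every element of [trcl x] is in [x] or in [trcl y] for some [y] in [x]. If [x] is in such a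
    [trcl y], then so is [y], which membership induction excludes. *)
Lemma trcl_irrefl (x : V) : ~ trcl x x.
Proof.
elim/V_ind: x => x IH xx.
have h : trcl x `<=` El x `|` \bigcup_(y in El x) trcl y.
  apply: trcl_sub => [y [yx|[z zx yz]] w wy|y yx]; last by left.
    by right; exists y => //; apply: sub_trcl.
  by right; exists z => //; apply: trcl_trans wy.
have [/in_irrefl//|[y yx yy]] := h _ xx.
by apply: (IH y yx); apply: trcl_trans yy _ yx.
Qed.

Lemma Homega2_transitive (T : set V) (x : V) :
  transitive_class T -> T #<= El omega1 -> El x `<=` T -> Homega2 x.
Proof.
move=> tT cT xT; apply: card_le_trans cT.
by apply: subset_card_le; apply: trcl_sub.
Qed.

Lemma Homega2_in (x y : V) : Homega2 x -> y ∈ x -> Homega2 y.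
Proof.
move=> Hx yx; apply: card_le_trans Hx.
by apply: subset_card_le; apply: trcl_in.
Qed.

Lemma Homega2_sub (x y : V) : Homega2 x -> El y `<=` El x -> Homega2 y.
Proof.
move=> Hx yx; apply: (@Homega2_transitive (trcl x)) => //; first exact: trcl_trans.
by move=> z /yx; apply: sub_trcl.
Qed.

Lemma omega2_Homega2 : El omega2 `<=` Homega2.
Proof.
move=> a a2; apply: (@Homega2_transitive (El a)) => //.
  by case: (omega2_ordinal a2).
exact: omega2_card.
Qed.

(** * Formulas and elementary substructures *)

Definition fImp n (a b : form n) : form n := fNot (fAnd a (fNot b)).
Definition fOr n (a b : form n) : form n := fImp (fNot a) b.
Definition fAll n (a : form n.+1) : form n := fNot (fEx (fNot a)).

Lemma scons0 n x (e : 'I_n -> V) : scons x e ord0 = x.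
Proof. by rewrite /scons unlift_none. Qed.

Lemma sconsS n x (e : 'I_n -> V) i : scons x e (lift ord0 i) = e i.
Proof. by rewrite /scons liftK. Qed.

Lemma scons_in n (K : set V) x (e : 'I_n -> V) :
  K x -> (forall i, K (e i)) -> forall i, K (scons x e i).
Proof. by move=> Kx Ke i; rewrite /scons; case: unlift. Qed.

Lemma sat_fAnd pi Y n (a b : form n) e (P Q : Prop) :
  (sat pi Y a e <-> P) -> (sat pi Y b e <-> Q) ->
  (sat pi Y (fAnd a b) e <-> (P /\ Q)).
Proof. by move=> /= -> ->. Qed.

Lemma sat_fImp pi Y n (a b : form n) e (P Q : Prop) :
  (sat pi Y a e <-> P) -> (sat pi Y b e <-> Q) ->
  (sat pi Y (fImp a b) e <-> (P -> Q)).
Proof.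
move=> /= -> ->; split=> [h p|h [p]]; last by apply; apply: h.
by apply: contrapT => q; apply: h.
Qed.

Lemma sat_fOr pi Y n (a b : form n) e (P Q : Prop) :
  (sat pi Y a e <-> P) -> (sat pi Y b e <-> Q) ->
  (sat pi Y (fOr a b) e <-> (P \/ Q)).
Proof.
move=> /= -> ->; split=> [h|[p|q] [np nq]//].
by apply: contrapT => npq; apply: h; split=> h; apply: npq; [left|right].
Qed.

Lemma sat_fEx pi Y n (a : form n.+1) e (P : V -> Prop) :
  (forall x, Homega2 x -> (sat pi Y a (scons x e) <-> P x)) ->
  (sat pi Y (fEx a) e <-> exists2 x, Homega2 x & P x).
Proof. by move=> h; split=> -[x Hx /h hx]; exists x => //; apply: hx. Qed.

Lemma sat_fAll pi Y n (a : form n.+1) e (P : V -> Prop) :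
  (forall x, Homega2 x -> (sat pi Y a (scons x e) <-> P x)) ->
  (sat pi Y (fAll a) e <-> forall x, Homega2 x -> P x).
Proof.
move=> h; split=> [k x Hx|k [x Hx /= nx]]; last by apply: nx; apply/h/k.
by apply/h => //; apply: contrapT => nx; apply: k; exists x.
Qed.

(** The tail is a function on the empty type ['I_0], so its value is immaterial. *)
Definition env1 (x : V) : 'I_1 -> V := scons x (fun _ => x).
Definition env2 (x y : V) : 'I_2 -> V := scons x (env1 y).

(** Translates a concrete formula into its meaning connective by connective, looking up the de
    Bruijn variables at the atoms. *)
Ltac satE :=
  repeat first [apply: sat_fAll => ? ? | apply: sat_fEx => ? ?
    | apply: sat_fOr | apply: sat_fImp | apply: sat_fAnd];
  rewrite /= ?/env2 ?/env1 !(sconsS, scons0); by [].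

Local Notation v0 := ord0.
Local Notation v1 := (lift ord0 ord0).
Local Notation v2 := (lift ord0 v1).
Local Notation v3 := (lift ord0 v2).
Local Notation v4 := (lift ord0 v3).

Lemma env1_in (K : set V) x : K x -> forall i, K (env1 x i).
Proof. by move=> Kx; apply: scons_in. Qed.

Lemma env2_in (K : set V) x y : K x -> K y -> forall i, K (env2 x y i).
Proof. by move=> Kx Ky; apply: scons_in => //; apply: env1_in. Qed.

(** This is the Tarski-Vaught criterion: such [K] are the carriers of elementary substructures. *)
Definition skolem_closed (pi : V -> V) (Y K : set V) : Prop :=
  K `<=` Homega2 /\ forall n (phi : form n.+1) (e : 'I_n -> V),
    (forall i, K (e i)) ->
    (exists2 w, Homega2 w & sat pi Y phi (scons w e)) ->
    exists2 w, K w & sat pi Y phi (scons w e).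

Lemma Sk_closed F (S : set V) : closed_under F (Sk F S).
Proof.
move=> n f e Ff Se T [Tcl ST]; apply: (Tcl n f e Ff) => i.
by apply: (Se i).
Qed.

Lemma Sk_sub F (S T : set V) : closed_under F T -> S `<=` T -> Sk F S `<=` T.
Proof. by move=> Tcl ST; apply: smallest_sub. Qed.

Lemma sub_Sk F (S : set V) : S `<=` Sk F S.
Proof. by move=> x Sx T [_]; apply. Qed.

Lemma Sk_mono F (S T : set V) : S `<=` T -> Sk F S `<=` Sk F T.
Proof.
move=> ST; apply: Sk_sub; first exact: Sk_closed.
by move=> x /ST; apply: sub_Sk.
Qed.

(** Members of the family map the domain into itself, which keeps the hull inside it; the Skolem
    functions supply the witnesses. *)
Lemma Sk_skolem_closed pi Y F (S : set V) : definable_skolem_functions pi Y F ->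
  S `<=` Homega2 -> skolem_closed pi Y (Sk F S).
Proof.
move=> [Fdef Fsk] SH.
have KH : Sk F S `<=` Homega2.
  by apply: Sk_sub => // n f e /Fdef[fH _] He; apply: fH.
split=> // n phi e Ke ex; have [f Ff fsk] := Fsk n phi.
exists (f e); first exact: Sk_closed.
by apply: (fsk e) => [i|]; [exact: KH (Ke i)|].
Qed.

(** The method here and below: if an object is the only solution of a formula with parameters in
    [K], the witness found in [K] is that object. *)
Lemma skolem_closed_pi pi Y K x : set_bij (El omega2) Homega2 pi ->
  skolem_closed pi Y K -> K x -> x ∈ omega2 -> K (pi x).
Proof.
move=> [piH _ _] [KH Ksk] Kx x2.
have E w : sat pi Y (fPi v1 v0) (scons w (env1 x)) <-> x ∈ omega2 /\ pi x = w.
  by satE.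
have [||w Kw /E[_ ->//]] := Ksk _ (fPi v1 v0) (env1 x); first exact: env1_in.
by exists (pi x); [apply: piH|apply/E].
Qed.

Lemma skolem_closed_pi_inv pi Y K x : set_bij (El omega2) Homega2 pi ->
  skolem_closed pi Y K -> x ∈ omega2 -> K (pi x) -> K x.
Proof.
move=> [_ piI _] [KH Ksk] x2 Kx.
have E w : sat pi Y (fPi v0 v1) (scons w (env1 (pi x))) <->
    w ∈ omega2 /\ pi w = pi x by satE.
have [||w Kw /E[w2 wx]] := Ksk _ (fPi v0 v1) (env1 (pi x)).
- exact: env1_in.
- by exists x; [apply: omega2_Homega2|apply/E].
- by rewrite -(piI w x) ?inE.
Qed.

Lemma skolem_closed_inter pi Y K a d : skolem_closed pi Y K -> K a -> K d ->
  K (interV a (El d)).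
Proof.
move=> [KH Ksk] Ka Kd.
pose phi : form 3 := fAll (fAnd
  (fImp (fMem v0 v1) (fAnd (fMem v0 v2) (fMem v0 v3)))
  (fImp (fAnd (fMem v0 v2) (fMem v0 v3)) (fMem v0 v1))).
have E w : sat pi Y phi (scons w (env2 a d)) <-> forall u, Homega2 u ->
    (u ∈ w -> u ∈ a /\ u ∈ d) /\ (u ∈ a /\ u ∈ d -> u ∈ w) by satE.
have [||w Kw /E h] := Ksk _ phi (env2 a d); first exact: env2_in.
  exists (interV a (El d)).
    by apply: Homega2_sub (KH _ Ka) _; rewrite El_interV => x [].
  by apply/E => u _; rewrite El_interV.
(* The quantifier of [phi] ranges over H(omega_2) only; this determines [w], because the elements of
   [w] and of [a] all lie there. *)
suff <- : w = interV a (El d) by [].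
apply: El_inj; rewrite El_interV; apply/seteqP; split=> u.
  by move=> uw; apply: (h u (Homega2_in (KH _ Kw) uw)).1.
by move=> [ua ud]; apply: (h u (Homega2_in (KH _ Ka) ua)).2.
Qed.

(** * Codes of enumerations and countable elements of elementary substructures *)

Fixpoint nest (x : V) (e : nat -> V) (n : nat) : V :=
  if n is n'.+1 then pairV (nest x e n') (e n') else x.

(** Each code contains the previous one, so a code in [trcl x] would lead down to [x] itself in
    [trcl x]. *)
Lemma nest_trcl x e n : (forall n, e n ∈ x) -> ~ trcl x (nest x e n).
Proof.
move=> ex; elim: n => [|n IH] /=; first exact: trcl_irrefl.
by move=> h; apply: IH; apply: trcl_trans h _ _; rewrite El_pairV; left.
Qed.

(** The two members of an unordered pair are told apart because [e k] lies in [x], while no code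
    does. *)
Lemma nest_in x e n m : (forall n, e n ∈ x) ->
  nest x e n ∈ nest x e m -> exists2 k, m = k.+1 & nest x e n = nest x e k.
Proof.
move=> ex; case: m => [|m] /=.
  by move/sub_trcl/(nest_trcl ex).
rewrite El_pairV => -[E|E]; first by exists m.
by case: (@nest_trcl x e n ex); rewrite E; apply: sub_trcl.
Qed.

Lemma nest_inj x e : (forall n, e n ∈ x) -> injective (nest x e).
Proof.
move=> ex; have nS n : nest x e n ∈ nest x e n.+1.
  by rewrite /= El_pairV; left.
elim=> [|n IH] [|m] // E.
- by have := nS m; rewrite -E => /(nest_in ex)[].
- by have := nS n; rewrite E => /(nest_in ex)[].
- by have := nS n; rewrite E => /(nest_in ex)[k [<-] /IH ->].
Qed.

(* An enumeration [e] of [x] is coded by the set of all [nest x e n].  By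
   membership induction, such a code [z] in [K] has all its elements in [K],
   without reference to the natural numbers of the structure. *)
Lemma skolem_closed_countable pi Y K x : skolem_closed pi Y K -> K x ->
  countable (El x) -> El x `<=` K.
Proof.
move=> [KH Ksk] Kx cx y0 y0x.
have [e eE] := countable_enum cx (ex_intro _ y0 y0x).
have ex n : e n ∈ x by rewrite eE; exists n.
(* With [z] for variable 0 and [x] for variable 1: every [t] in [z] other than [x] is the only
   member of [z] containing some [u] in [z], and every [y] in [x] is the only element of [x] in some
   [t] in [z]. *)
pose phi : form 2 := fAnd
  (fAll (fImp (fMem v0 v1) (fOr (fEq v0 v2) (fEx (fAnd (fMem v0 v2)
    (fAnd (fMem v0 v1) (fAll (fImp (fAnd (fMem v0 v3) (fMem v1 v0))
      (fEq v0 v2)))))))))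
  (fAll (fImp (fMem v0 v2) (fEx (fAnd (fMem v0 v2) (fAnd (fMem v1 v0)
    (fAll (fImp (fAnd (fMem v0 v4) (fMem v0 v1)) (fEq v0 v2)))))))).
have E z : sat pi Y phi (scons z (env1 x)) <->
    (forall t, Homega2 t -> t ∈ z -> t = x \/ exists2 u, Homega2 u &
      u ∈ z /\ u ∈ t /\ forall t', Homega2 t' -> t' ∈ z /\ u ∈ t' -> t' = t) /\
    (forall y, Homega2 y -> y ∈ x -> exists2 t, Homega2 t &
      t ∈ z /\ y ∈ t /\ forall y', Homega2 y' -> y' ∈ x /\ y' ∈ t -> y' = y).
  by satE.
have [||z Kz /E[hpred henum]] := Ksk _ phi (env1 x); first exact: env1_in.
  pose z := vset (range (nest x e)).
  have zE : El z = range (nest x e) by apply/El_vset/small_range.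
  have Hz : Homega2 z.
    apply: (@Homega2_transitive (trcl x `|` range (nest x e))).
    - move=> t [tx|[[|n] _ <-]] u; first by move=> ut; left; apply: trcl_trans ut.
        by move=> ux; left; apply: sub_trcl.
      by rewrite /= El_pairV => -[->|->]; [right; exists n|left; apply: sub_trcl].
    - by apply: card_setU_countable; [apply: KH|apply: countable_range].
    - by rewrite zE; right.
  exists z => //; apply/E; split=> [t Ht|y Hy].
    rewrite zE => -[[|n] _ <-]; [by left|right].
    have nz : nest x e n ∈ z by rewrite zE; exists n.
    exists (nest x e n); first exact: Homega2_in nz.
    split=> //; split; first by rewrite /= El_pairV; left.
    move=> t' _ [] [m _ <-] /(nest_in ex)[k -> /(nest_inj ex) ->//].
  move=> yx; have [n _ <-] : range e y by rewrite -eE.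
  have nz : nest x e n.+1 ∈ z by rewrite zE; exists n.+1.
  exists (nest x e n.+1); first exact: Homega2_in nz.
  split=> //; split; first by rewrite /= El_pairV; right.
  move=> y' _ []; rewrite /= El_pairV => y'x [E'|//].
  by case: (@nest_trcl x e n ex); rewrite -E'; apply: sub_trcl.
(* Either [t] is [x], or it is definable from [z] and its predecessor [u], which is in [K] by
   induction. *)
have zK t : t ∈ z -> K t.
  elim/V_ind: t => t IH tz.
  have Ht := Homega2_in (KH _ Kz) tz.
  have [->//|[u Hu [uz [ut tuniq]]]] := hpred t Ht tz.
  pose psi : form 3 := fAnd (fMem v0 v1) (fMem v2 v0).
  have Epsi w : sat pi Y psi (scons w (env2 z u)) <-> w ∈ z /\ u ∈ w by satE.
  have [||w Kw /Epsi[wz uw]] := Ksk _ psi (env2 z u).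
  - by apply: env2_in => //; apply: IH.
  - by exists t => //; apply/Epsi.
  - by rewrite -(tuniq w) //; apply: KH.
(* Now [y0] is definable from [x] and a code [t] that is known to be in [K]. *)
have [t Ht [tz [y0t yuniq]]] := henum y0 (Homega2_in (KH _ Kx) y0x) y0x.
pose psi : form 3 := fAnd (fMem v0 v2) (fMem v0 v1).
have Epsi w : sat pi Y psi (scons w (env2 t x)) <-> w ∈ x /\ w ∈ t by satE.
have [||w Kw /Epsi[wx wt]] := Ksk _ psi (env2 t x).
- by apply: env2_in => //; apply: zK.
- by exists y0; [exact: Homega2_in (KH _ Kx) y0x|apply/Epsi].
- by rewrite -(yuniq w) //; apply: KH.
Qed.

(** The ordinal [b] need not be in [K]. If some element of [a] is not below [b], the least such [d]
    cuts off the same segment, and [d] is in [K] because [a] is countable; otherwise the segment is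
    [a] itself. *)
Lemma skolem_closed_initial_segment pi Y K a (b : V) : skolem_closed pi Y K ->
  K a -> El a `<=` El omega2 -> countable (El a) -> ordinal_set b ->
  K (interV a (El b)).
Proof.
move=> Ksk Ka a2 ca ob.
have [h|h] := pselect ((El a `\` El b) !=set0); last first.
  have -> : interV a (El b) = a; last by [].
  apply: El_inj; rewrite El_interV; apply/seteqP; split=> [x []//|x xa].
  by split=> //; apply: contrapT => nxb; apply: h; exists x.
have [|d [[da ndb] dmin]] := exists_least_ordinal _ h.
  by move=> x [/a2/omega2_ordinal].
have -> : interV a (El b) = interV a (El d); last first.
  apply: (skolem_closed_inter Ksk Ka).
  exact: (skolem_closed_countable Ksk Ka ca).
have od := omega2_ordinal (a2 _ da).
apply: El_inj; rewrite !El_interV; apply/seteqP; split=> x [xa xE]; split=> //.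
  have [//|dx] := ordinal_in_or_sub (omega2_ordinal (a2 _ xa)) od.
  have [//|bd] := ordinal_in_or_sub od ob.
  by case: (@in_irrefl x); apply/dx/bd.
apply: contrapT => nxb; case: (@in_irrefl x).
by apply: (dmin x).
Qed.

(** * Adequacy *)

(** The hulls of the points of [clubC F] below [b] form a chain, so their union is closed under
    functions of finite arity. Each of these hulls adds no ordinals below [omega2] to its own
    point. *)
Lemma Lambda_Sk F (b : V) : Lambda F b -> Sk F (El b) `&` El omega2 = El b.
Proof.
move=> [b2 _ [b0 bE]]; have ob := omega2_ordinal b2.
pose D := clubC F `&` El b.
have D_above x : x ∈ b -> exists2 c, D c & x ∈ c.
  by move=> xb; have [c [Cc cb xc]] := supV_sub_in bE xb; exists c.
(* Finitely many arguments lie in a single hull of the chain. For arity 0 some point of the chain is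
   still required, whence the use of [b0]. *)
have fin n (e : 'I_n -> V) :
    (forall i, exists2 c, D c & Sk F (El c) (e i)) ->
    exists2 c, D c & forall i, Sk F (El c) (e i).
  elim: n e => [|n IH] e De.
    have [x xb] : El b !=set0.
      by apply/set0P/negP => /eqP h; apply: b0; apply: El_inj; rewrite h El_emptyV.
    by have [c Dc _] := D_above x xb; exists c => // -[].
  have [c Dc cS] := IH (fun i => e (lift ord0 i)) (fun i => De _).
  have [d Dd dS] := De ord0.
  have oc := ordinal_in ob Dc.2; have od := ordinal_in ob Dd.2.
  have [m Dm [cm dm]] : exists2 m, D m & El c `<=` El m /\ El d `<=` El m.
    have [/(ordinal_sub_in od) cd|dc] := ordinal_in_or_sub oc od.
      by exists d => //; split.
    by exists c => //; split.
  exists m => // i; case: (unliftP ord0 i) => [j|] ->.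
    by apply: Sk_mono cm _ _.
  by apply: Sk_mono dm _ _.
apply/seteqP; split=> x; last first.
  by move=> xb; split; [exact: sub_Sk|exact: omega2_trans xb].
move=> [xS x2].
have [] : (\bigcup_(c in D) Sk F (El c)) x.
  apply: Sk_sub xS => [n f e Ff Ue|y yb].
    have [|c Dc ce] := fin n e; first by move=> i; have [c Dc ?] := Ue i; exists c.
    by exists c => //; apply: (Sk_closed Ff).
  by have [c Dc yc] := D_above y yb; exists c => //; apply: sub_Sk.
move=> c [[c2 cE] cb] xc; apply: (ordinal_trans ob cb).
by rewrite -cE.
Qed.

Lemma Sk_ordinal_skolem_closed pi Y F (b : V) : definable_skolem_functions pi Y F ->
  b ∈ omega2 -> skolem_closed pi Y (Sk F (El b)).
Proof.
move=> FS b2; apply: Sk_skolem_closed => // x xb.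
by apply: omega2_Homega2; apply: omega2_trans xb.
Qed.

(* Below [g] there are at most [omega1] members of [Y] by thinness, so the
   least bound of their codes is definable from [g] and lies below [b]. *)
Lemma initial_segment_code pi Y F Gamma (L b : V) :
  set_bij (El omega2) Homega2 pi ->
  stationary_countable omega2 Y -> thin Y -> closed_initial_segments Y ->
  definable_skolem_functions pi Y F ->
  Gamma `<=` Lambda F -> stationary omega2 Gamma ->
  Y L -> Gamma b -> exists2 x, x ∈ b & pi x = interV L (El b).
Proof.
move=> pib [Yc _] Ythin Yinit FS GL Gst YL Gb.
have [piH piI piS] := pib.
have Lb := GL _ Gb; have b2 := Lambda_omega2 Lb; have ob := omega2_ordinal b2.
have [KH Ksk] := Sk_ordinal_skolem_closed FS b2.
have Ya := Yinit _ _ YL b2.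
set a := interV L (El b) in Ya *.
have ab : El a `<=` El b by rewrite El_interV => x [].
(* The countable segment [a] is bounded below [b], since [b] has cofinality [omega1]. *)
have [g gb ag] := Lambda_bounded Lb ab (Yc _ Ya).2.
have g2 : g ∈ omega2 by apply: omega2_trans gb.
pose S := [set x | x ∈ omega2 /\ Y (pi x) /\ El (pi x) `<=` El g].
have [||d d2 Sd] := @omega2_bounded F Gamma S GL Gst.
- by move=> x [].
(* A member of [Y] inside [g] equals its own trace on [g], so [pi] injects [S] into the traces
   counted by thinness. *)
- apply: card_le_trans (Ythin _ g2); apply/card_le_inj; exists pi; split.
    move=> x [x2 [Yx xg]]; exists (pi x) => //.
    by apply: El_inj; rewrite El_interV; apply/setIidl.
  by move=> x y [x2 _] [y2 _]; apply: piI; rewrite inE.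
(* The first conjunct only says that variable 0 is in the domain [omega2] of [pi]; the second says
   that every member of [Y] included in [g] has a code below it. *)
pose phi : form 2 := fAnd (fEx (fPi v1 v0)) (fAll (fImp
  (fAnd (fY v0) (fAll (fImp (fMem v0 v1) (fMem v0 v3))))
  (fEx (fAnd (fMem v0 v2) (fPi v0 v1))))).
have E w : sat pi Y phi (scons w (env1 g)) <->
    (exists2 y, Homega2 y & w ∈ omega2 /\ pi w = y) /\
    (forall a, Homega2 a -> Y a /\ (forall u, Homega2 u -> u ∈ a -> u ∈ g) ->
      exists2 x, Homega2 x & x ∈ w /\ x ∈ omega2 /\ pi x = a) by satE.
have [||w Kw /E[[y _ [w2 _]] hw]] := Ksk _ phi (env1 g).
- by apply: env1_in; apply: sub_Sk.
- exists d; first exact: omega2_Homega2.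
  apply/E; split; first by exists (pi d) => //; apply: piH.
  move=> c Hc [Yc' cg]; have [x x2 xc] := piS c Hc.
  exists x; first exact: omega2_Homega2.
  split=> //; apply: Sd; split=> //; rewrite xc; split=> // u uc.
  by apply: cg => //; apply: Homega2_in uc.
have wb : w ∈ b by rewrite -(Lambda_Sk Lb).
have [||x _ [xw [x2 xa]]] := hw a.
- by apply: Homega2_sub (omega2_Homega2 g2) ag.
- by split=> // u _; apply: ag.
- by exists x => //; apply: ordinal_trans wb xw.
Qed.

Lemma interV_sub (M : V) (P Q : set V) : P `<=` Q ->
  interV (interV M Q) P = interV M P.
Proof.
move=> PQ; apply: El_inj; rewrite !El_interV -setIA; congr (_ `&` _).
by apply/setIidr.
Qed.

(** The elements of [M] witnessing the condition at [b] lie below [b], so they survive a cut at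
    [c]. *)
Lemma Gamma_at_interV (Gamma : set V) (M b c : V) : Gamma `<=` El omega2 ->
  Gamma_at Gamma M b -> El b `<=` El c -> Gamma_at Gamma (interV M (El c)) b.
Proof.
move=> G2 /(Gamma_atP _ _ G2)[Gb h] bc; apply/Gamma_atP => //; split=> // d Gd db.
have [m [mM mb dm]] := h d Gd db; exists m; split=> //.
by rewrite El_interV; split=> //; apply: bc.
Qed.

Lemma Gamma_at_sub (Gamma : set V) (L N : V) : Gamma `<=` El omega2 ->
  El L `<=` El N -> Gamma_at Gamma L `<=` Gamma_at Gamma N.
Proof.
move=> G2 LN b /(Gamma_atP _ _ G2)[Gb h]; apply/Gamma_atP => //; split=> // c Gc cb.
by have [m [mL mb cm]] := h c Gc cb; exists m; split=> //; apply: LN.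
Qed.

(** The pairwise clause of [adequate], isolated in order to exploit its symmetry. *)
Definition comparable_models (F : forall n, set (('I_n -> V) -> V))
    (Gamma : set V) (M N : V) : Prop :=
  let b := comparison_point Gamma M N in
  [\/ interV M (El b) = interV N (El b),
      Sk F (El N) (interV M (El b))
    | Sk F (El M) (interV N (El b))].

Lemma comparable_modelsC F Gamma M N :
  comparable_models F Gamma M N -> comparable_models F Gamma N M.
Proof.
rewrite /comparable_models comparison_pointC => -[h|h|h].
- by constructor 1.
- by constructor 3.
- by constructor 2.
Qed.

Theorem proposition3p9
  (two_omega1 : [set x : V | El x `<=` El omega1] #= El omega2)
  (pi : V -> V) (pi_bij : set_bij (El omega2) Homega2 pi)
  (Y : set V) (Y_stationary : stationary_countable omega2 Y)
  (Y_thin : thin Y) (Y_closed : closed_initial_segments Y)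
  (F : forall n, set (('I_n -> V) -> V))
  (F_skolem : definable_skolem_functions pi Y F)
  (Gamma : set V) (Gamma_Lambda : Gamma `<=` Lambda F)
  (Gamma_stationary : stationary omega2 Gamma)
  (A : set V) (A_adequate : adequate F Y Gamma A)
  (N : V) (NA : A N) (A_closed : closed_for F Gamma N A)
  (B : set V) (B_adequate : adequate F Y Gamma B)
  (AB : A `&` Sk F (El N) `<=` B) (BN : B `<=` Sk F (El N)) :
  adequate F Y Gamma (A `|` B).
Proof.
have [[AX Acmp] [BX Bcmp]] := (A_adequate, B_adequate).
have G2 : Gamma `<=` El omega2 by move=> b /Gamma_Lambda/Lambda_omega2.
have [Yc _] := Y_stationary.
have modelP M : models F Y M ->
    [/\ El M `<=` El omega2, countable (El M) & skolem_closed pi Y (Sk F (El M))].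
  move=> [/Yc[M2 cM] _ _]; split=> //.
  by apply: Sk_skolem_closed => // x /M2/omega2_Homega2.
have [N2 cN NK] := modelP _ (AX _ NA).
(* Pairs within [A] or within [B] are comparable by hypothesis, so only mixed pairs remain. *)
suff cmp M L : A M -> B L -> comparable_models F Gamma L M.
  split=> [M [/AX|/BX]//|M L [AM|BM] [AL|BL]].
  - exact: Acmp.
  - exact/comparable_modelsC/cmp.
  - exact: cmp.
  - exact: Bcmp.
move=> AM BL.
have [[M2 cM MK] [L2 cL LK]] := (modelP _ (AX _ AM), modelP _ (BX _ BL)).
(* [L] is a countable element of the hull of [N], hence a subset of it, and the ordinals of that
   hull below [omega2] are those of [N]. *)
have LN : El L `<=` El N.
  have [_ <- _] := AX _ NA => x xL; split; last exact: L2.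
  exact: skolem_closed_countable NK (BN _ BL) cL _ xL.
rewrite /comparable_models; set b := comparison_point Gamma L M.
have [/getPex|none] :=
    pselect (exists b, is_largest (Gamma_at Gamma L `&` Gamma_at Gamma M) b);
  last first.
  (* Without a largest common point [get] returns the default [emptyV], below which both segments
     are empty. *)
  have -> : b = emptyV by apply: getPN => x bx; apply: none; exists x.
  by constructor 1; apply: El_inj; rewrite !El_interV El_emptyV !setI0.
rewrite -/(comparison_point Gamma L M) -/b => -[[Lb Mb] _].
have [Gb _] := Lb; have b2 := G2 _ Gb; have ob := omega2_ordinal b2.
have Nb := Gamma_at_sub G2 LN Lb.
have [_ cmax] := comparison_pointP Gamma_Lambda Gamma_stationary M2 cM Mb Nb.
have {cmax}bc := cmax _ (conj Mb Nb).
set c := comparison_point Gamma M N in bc.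
have [x xb xL] : exists2 x, x ∈ b & pi x = interV L (El b).
  apply: initial_segment_code pi_bij Y_stationary Y_thin Y_closed F_skolem
    Gamma_Lambda Gamma_stationary _ Gb.
  by case: (BX _ BL).
have x2 : x ∈ omega2 by apply: omega2_trans xb.
have xN : x ∈ N.
  have [_ <- _] := AX _ NA; split=> //.
  apply: (skolem_closed_pi_inv pi_bij NK x2); rewrite xL.
  exact: skolem_closed_initial_segment NK (BN _ BL) L2 cL ob.
have xM_done : x ∈ M -> Sk F (El M) (interV L (El b)).
  by move=> xM; rewrite -xL; apply: skolem_closed_pi pi_bij MK _ x2; apply: sub_Sk.
have xNc : x ∈ interV N (El c) by rewrite El_interV; split=> //; apply: bc.
have := Acmp M N AM NA; rewrite /= -/c => -[MN|MN|NM].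
- constructor 2; apply: xM_done.
  by move: xNc; rewrite -MN El_interV => -[].
- set M' := interV M (El c) in MN.
  have AM' : A M' by apply: A_closed.
  have BM' : B M' by apply: AB.
  have [M'2 cM' _] := modelP _ (AX _ AM').
  (* [b] remains a common point of [L] and [M'], so their comparison point [d] is at least [b], and
     comparisons at [d] can be cut down to [b]. *)
  have M'b : Gamma_at Gamma M' b by apply: Gamma_at_interV.
  have [_ dmax] := comparison_pointP Gamma_Lambda Gamma_stationary L2 cL Lb M'b.
  have {dmax}bd := dmax _ (conj Lb M'b).
  have M'E : interV M' (El b) = interV M (El b) by apply: interV_sub.
  have := Bcmp L M' BL BM'; set d := comparison_point Gamma L M' in bd *.
  move=> [E|h|h].
  + by constructor 1; rewrite -(interV_sub L bd) E interV_sub.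
  + constructor 2; apply: (@Sk_mono F (El M')); first by rewrite El_interV => ? [].
    rewrite -(interV_sub L bd); have [_ _ M'K] := modelP _ (AX _ AM').
    apply: skolem_closed_initial_segment M'K h _ _ ob; rewrite El_interV.
      by move=> y [/L2].
    by apply: card_le_trans cL; apply: subset_card_le => ? [].
  + constructor 3; rewrite -M'E -(interV_sub M' bd).
    apply: skolem_closed_initial_segment LK h _ _ ob; rewrite El_interV.
      by move=> y [/M'2].
    by apply: card_le_trans cM'; apply: subset_card_le => ? [].
(* The segment of [N] below [c] is a countable element of the hull of [M], so its element [x] is in
   that hull and hence in [M]. *)
- constructor 2; apply: xM_done.
  have [_ <- _] := AX _ AM; split=> //.
  apply: skolem_closed_countable MK NM _ _ xNc; rewrite El_interV.
  by apply: card_le_trans cN; apply: subset_card_le => ? [].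
Qed.
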